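(* Let $r \geq 1$ be an integer and let $b > 1$ be an integer with $\gcd(2,b) = 1$ such that $2^r b^2$ is almost perfect. Then $$r < \log_2 b - 1,$$ i.e. $2^{r+1} < b$.
   Context: $\sigma(x)$ denotes the sum of the positive divisors of $x$. A positive integer $y$ is almost perfect if $\sigma(y) = 2y - 1$. *)

(* Defs.v *)
From mathcomp Require Import all_boot.

Set Implicit Arguments.
Unset Strict Implicit.
Unset Printing Implicit Defensive.

Definition sigma (n : nat) : nat := \sum_(d <- divisors n) d.

(* The truncated subtraction is harmless, since y is positive. *)
Definition almost_perfect (y : nat) : Prop :=
  (0 < y) /\ sigma y = 2 * y - 1.

(* Main.v *)
Require Import Defs.
From mathcomp Require Import all_boot all_order all_algebra.
From mathcomp Require Import reals exp.
From mathcomp Require Import zify.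

Import GRing.Theory Num.Theory.

(** Put [M = 2 ^ (r + 1) - 1].  The products of a divisor of [2 ^ r] with one of
    [1], [b], [b ^ 2] are distinct divisors of [2 ^ r * b ^ 2], so that
    [M * (b ^ 2 + b + 1) <= sigma (2 ^ r * b ^ 2) = (M + 1) * b ^ 2 - 1].
    Hence [M * (b + 1) <= (b - 1) * (b + 1)], so [2 ^ (r + 1) <= b], and
    equality is impossible because [b] is odd. *)

Lemma leq_sum_sigma (s : seq nat) (n : nat) :
  0 < n -> uniq s -> {in s, forall d, d %| n} -> \sum_(d <- s) d <= sigma n.
Proof.
move=> n_gt0 s_uniq s_dvd.
have s_perm : perm_eq s [seq d <- divisors n | d \in s].
  apply: uniq_perm; rewrite ?filter_uniq ?divisors_uniq // => d.
  rewrite mem_filter -dvdn_divisors //.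
  by case: (boolP (d \in s)) => // /s_dvd.
(* Divisors outside [s] now contribute 0, so the sums compare termwise. *)
rewrite (perm_big _ s_perm) big_filter big_mkcond /sigma.
by apply: leq_sum => d _; case: ifP.
Qed.

(** By coprimality, [d %| m] and [e %| n] are recovered from [d * e] as its gcds with [m] and [n],
    so distinct pairs give distinct divisors of [m * n]. *)
Lemma sigma_mul_leq (m n : nat) :
  0 < m -> 0 < n -> coprime m n -> sigma m * sigma n <= sigma (m * n).
Proof.
move=> m_gt0 n_gt0 co_mn.
have gcd_mul d e : d \in divisors m -> e \in divisors n ->
    gcdn m (d * e) = d /\ gcdn n (d * e) = e.
  rewrite -!dvdn_divisors // => d_m e_n; split.
    by rewrite Gauss_gcdl ?(coprime_dvdr e_n) //; apply/gcdn_idPr.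
  rewrite Gauss_gcdr; first exact/gcdn_idPr.
  by rewrite (coprime_dvdr d_m) // coprime_sym.
rewrite {1 2}/sigma big_distrlr /=.
rewrite -(big_allpairs_dep (h := fun d e => d * e) (F := id)).
apply: leq_sum_sigma; first by rewrite muln_gt0 m_gt0.
- apply: allpairs_uniq; rewrite ?divisors_uniq //.
  move=> _ _ /allpairsP[[d e] /= [d_m e_n ->]]
    /allpairsP[[d' e'] /= [d'_m e'_n ->]] /= eq_mul.
  have := gcd_mul d e d_m e_n; rewrite eq_mul.
  by have [-> ->] := gcd_mul d' e' d'_m e'_n => -[-> ->].
- move=> _ /allpairsP[[d e] /= [d_m e_n ->]].
  by rewrite dvdn_mul // dvdn_divisors.
Qed.

(** Counting only the powers of [p] as divisors lets [p] be composite, as in the use at [p = b],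
    [k = 2]. *)
Lemma leq_sigma_expn (p k : nat) : 1 < p -> \sum_(i < k.+1) p ^ i <= sigma (p ^ k).
Proof.
move=> p_gt1.
rewrite -(big_mkord xpredT (expn p)) -(big_map (expn p) xpredT id).
apply: leq_sum_sigma; first by rewrite expn_gt0 ltnW.
- by rewrite map_inj_uniq ?iota_uniq //; apply: expnI.
- by move=> d /mapP[i]; rewrite mem_index_iota => i_le ->; apply: dvdn_exp2l.
Qed.

Lemma almost_perfect_ltn (r b : nat) :
  1 < b -> odd b -> almost_perfect (2 ^ r * b ^ 2) -> 2 ^ r.+1 < b.
Proof.
move=> b_gt1 b_odd [_ sigmaE].
have co_b : coprime (2 ^ r) (b ^ 2) by rewrite coprimeXl ?coprimeXr ?coprime2n.
have := sigma_mul_leq (2 ^ r) (b ^ 2).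
rewrite !expn_gt0 (ltnW b_gt1) => /(_ isT isT co_b); rewrite sigmaE => sigma_le.
have := leq_sigma_expn 2 r isT.
have -> : \sum_(i < r.+1) 2 ^ i = (2 ^ r.+1).-1 by rewrite predn_exp mul1n.
have := leq_sigma_expn b 2 b_gt1.
rewrite !big_ord_recr big_ord0 /= expn0 expn1 => sigma_b sigma_2.
have b_neq : b <> 2 ^ r.+1 by move=> b_eq; rewrite b_eq oddX in b_odd.
have := leq_trans (leq_mul sigma_2 sigma_b) sigma_le.
move: b_neq (expn_gt0 2 r); rewrite expnS /=.
(* The terms [2 * q * b ^ 2] cancel, leaving [2 * q * (b + 1) <= b * (b + 1)]; as [q] is positive,
   the predecessor and the subtraction do not truncate. *)
by move: (2 ^ r) => q; nia.
Qed.

Theorem theorem3 (R : realType) (r b : nat) (hr : (1 <= r)%N) (hb : (1 < b)%N)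
  (hcop : gcdn 2 b = 1%N) (hap : almost_perfect (2 ^ r * b ^ 2)%N) :
  ((r%:R : R) < ln b%:R / ln 2%:R - 1)%R /\ (2 ^ (r + 1) < b)%N.
Proof.
have b_odd : odd b by rewrite -coprime2n /coprime hcop.
have lt_b : 2 ^ (r + 1) < b by rewrite addn1; apply: almost_perfect_ltn.
split=> //.
have ln2_gt0 : (0 < ln (2%:R : R))%R by rewrite ln_gt0 // ltr1n.
(* Clearing the denominator [ln 2] turns the goal into [ln (2 ^ (r + 1)) < ln b]. *)
rewrite ltrBrDr natr1 ltr_pdivlMr // mulr_natl -lnXn ?ltr0n // -natrX.
by rewrite ltr_ln ?posrE ?ltr0n ?expn_gt0 ?(ltnW hb) // ltr_nat -(addn1 r).
Qed.
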